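(* Let $K$ be a field of characteristic $\neq 2$ and let $N$ be a Lie-solvable Novikov algebra over $K$. Then the ideal $[N,N]$ of $N$ is right nilpotent.
   Context: All algebras are not necessarily associative, not necessarily unital, of arbitrary dimension. A Novikov algebra over $K$ is a $K$-vector space $N$ with a bilinear product satisfying $(x,y,z)=(y,x,z)$ and $(xy)z=(xz)y$ for all $x,y,z\in N$, where $(x,y,z)=(xy)z-x(yz)$. With the commutator $[x,y]=xy-yx$, $N$ becomes a Lie algebra, denoted $N^{(-)}$. $N$ is called Lie-solvable if the Lie algebra $N^{(-)}$ is solvable. $[N,N]$ denotes the $K$-linear span of all commutators $[x,y]$, $x,y\in N$; over a field of characteristic $\neq 2$ it is a two-sided ideal of $N$, and it is regarded as an algebra under the product of $N$. For an algebra $A$, the right powers are $A^{[1]}=A$ and $A^{[m+1]}=A^{[m]}A$ for $m\ge 1$ (where the product of two subspaces is the linear span of the products of their elements); $A$ is right nilpotent if $A^{[m]}=0$ for some positive integer $m$. *)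

(* Defs.v *)
From mathcomp Require Import all_boot all_order all_algebra.
From mathcomp Require Import boolp classical_sets.

Set Implicit Arguments.
Unset Strict Implicit.
Unset Printing Implicit Defensive.

Import GRing.Theory.

Local Open Scope classical_set_scope.
Local Open Scope ring_scope.

Definition associator (N : zmodType) (mul : N -> N -> N) (x y z : N) : N :=
  mul (mul x y) z - mul x (mul y z).

Definition commutator (N : zmodType) (mul : N -> N -> N) (x y : N) : N :=
  mul x y - mul y x.

(* Bilinearity of the product is not included here. *)
Definition novikov (N : zmodType) (mul : N -> N -> N) : Prop :=
  (forall x y z, associator mul x y z = associator mul y x z) /\
  (forall x y z, mul (mul x y) z = mul (mul x z) y).

Definition lin_span (K : fieldType) (V : lmodType K) (S : set V) : set V :=
  [set x | exists (n : nat) (a : 'I_n -> K) (v : 'I_n -> V),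
             (forall i, S (v i)) /\ x = \sum_(i < n) a i *: v i].

(* For subspaces A and B, this is the product AB with respect to [mul]; for
   [commutator mul] in place of [mul] it is [A, B]. *)
Definition prod_span (K : fieldType) (V : lmodType K) (mul : V -> V -> V)
    (A B : set V) : set V :=
  lin_span [set mul x y | x in A & y in B].

Definition derived_series (K : fieldType) (L : lmodType K)
    (br : L -> L -> L) (n : nat) : set L :=
  iter n (fun D => prod_span br D D) setT.

Definition lie_solvable (K : fieldType) (N : lmodType K)
    (mul : N -> N -> N) : Prop :=
  exists n, derived_series (commutator mul) n = [set 0].

(* A^[m] for m >= 1; the value at m = 0 is A and carries no meaning. *)
Definition right_power (K : fieldType) (V : lmodType K) (mul : V -> V -> V)
    (A : set V) (m : nat) : set V :=
  iter m.-1 (fun B => prod_span mul B A) A.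

Definition right_nilpotent (K : fieldType) (V : lmodType K)
    (mul : V -> V -> V) (A : set V) : Prop :=
  exists m, (0 < m)%N /\ right_power mul A m = [set 0].

Definition commutator_ideal (K : fieldType) (N : lmodType K)
    (mul : N -> N -> N) : set N :=
  prod_span (commutator mul) setT setT.

(* Main.v *)
Require Import Defs.
From mathcomp Require Import all_boot all_order all_algebra.
From mathcomp Require Import boolp classical_sets.

Import GRing.Theory.
Local Open Scope ring_scope.

(** The proof studies the operators T_{u,c} : x |-> (x,u,c).  If a Novikov
    algebra is realised inside a commutative differential algebra with
    xy := x d(y), then T_{u,c} x = - x u d^2(c), which makes the following
    facts visible.

    - The T's commute ([associatorAC]), because T_{u,c} = R_c R_u - R_{uc} and
      right multiplications commute.  Together with (x,u,c) = (u,x,c) this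
      gives T_{y,c} T_{z,d} = T_{(z,y,c),d} ([associator_nest]): a product of
      two T's is again a T, with a deeper first index.

    - Let D_0 = N and D_{j+1} = [D_j, D_j].  From
        [ac,b] = [a,b]c + (a,b,c)   and   [a,bc] = [a,b]c - (a,b,c),
      adding and subtracting, and dividing by 2, each D_j is a right ideal and
      (D_j, D_j, N) lies in D_{j+1} ([associator_derived]).

    So a product of 2^j operators T_{u,c} is a single T_{y,c} with y in D_j
    ([iter_associator_derived]), and all products of 2^n of them vanish as
    soon as D_n = 0.  Finally R_{[a,b]} = T_{b,a} - T_{a,b}
    ([mulr_commutator]), so right multiplication by an element of [N,N] is a
    combination of T's and any 2^n such multiplications compose to zero. *)

(** * Linear spans *)

Lemma lin_span_sub (K : fieldType) (V : lmodType K) (S W : set V) :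
  W 0 -> (forall a x y, W x -> W y -> W (a *: x + y)) ->
  (forall x, S x -> W x) -> forall x, lin_span S x -> W x.
Proof.
move=> W0 Wlin SW _ [n [a [v [Sv ->]]]].
elim/big_rec: _ => // i y _ Wy.
by apply: Wlin => //; apply: SW.
Qed.

Lemma lin_span_incl (K : fieldType) (V : lmodType K) (S : set V) (x : V) :
  S x -> lin_span S x.
Proof.
move=> Sx; exists 1%N, (fun=> 1), (fun=> x); split=> //.
by rewrite big_ord1 scale1r.
Qed.

Lemma lin_span0 (K : fieldType) (V : lmodType K) (S : set V) : lin_span S 0.
Proof.
by exists 0%N, (fun=> 0), (fun=> 0); split=> [[]|] //; rewrite big_ord0.
Qed.

Lemma lin_spanP (K : fieldType) (V : lmodType K) (S : set V) a x y :
  lin_span S x -> lin_span S y -> lin_span S (a *: x + y).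
Proof.
move=> [n [b [v [Sv ->]]]] [m [c [w [Sw ->]]]].
exists (n + m)%N.
exists (fun i => match split i with inl j => a * b j | inr j => c j end).
exists (fun i => match split i with inl j => v j | inr j => w j end).
split=> [i|]; first by case: (split i).
rewrite big_split_ord /= scaler_sumr; congr (_ + _); apply: eq_bigr => i _.
  by rewrite (unsplitK (inl i)) scalerA.
by rewrite (unsplitK (inr i)).
Qed.

Lemma lin_spanD (K : fieldType) (V : lmodType K) (S : set V) x y :
  lin_span S x -> lin_span S y -> lin_span S (x + y).
Proof. by move=> Sx Sy; rewrite -[x]scale1r; apply: lin_spanP. Qed.

Lemma lin_spanZ (K : fieldType) (V : lmodType K) (S : set V) a x :
  lin_span S x -> lin_span S (a *: x).
Proof.
by move=> Sx; rewrite -[_ *: x]addr0; apply: lin_spanP => //; apply: lin_span0.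
Qed.

Lemma lin_spanB (K : fieldType) (V : lmodType K) (S : set V) x y :
  lin_span S x -> lin_span S y -> lin_span S (x - y).
Proof.
by move=> Sx Sy; rewrite addrC -scaleN1r; apply: lin_spanP.
Qed.

Lemma lin_span_half (K : fieldType) (char_neq2 : 2%N \notin [pchar K])
    (V : lmodType K) (S : set V) (x : V) :
  lin_span S (x + x) -> lin_span S x.
Proof.
have nz2 : 2%:R != 0 :> K by move: char_neq2; rewrite inE /=.
move=> Sxx; suff -> : x = 2%:R^-1 *: (x + x) by apply: lin_spanZ.
by rewrite -mulr2n -scaler_nat scalerA mulVf // scale1r.
Qed.

(** * Associators in a Novikov algebra *)

Lemma associatorPl (K : fieldType) (N : lmodType K)
    (mul : {bilinear N -> N -> N}) a x y u c :
  associator mul (a *: x + y) u c =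
  a *: associator mul x u c + associator mul y u c.
Proof. by rewrite /associator !linearPl scalerBr opprD addrACA. Qed.

Lemma associator_mull (K : fieldType) (N : lmodType K)
    (mul : {bilinear N -> N -> N}) x w u c :
  novikov mul ->
  associator mul (mul x w) u c = mul (associator mul x u c) w.
Proof.
case=> _ rcomm; rewrite /associator linearBl.
by rewrite (rcomm x w u) (rcomm _ w c) (rcomm x w).
Qed.

Lemma associatorAC (K : fieldType) (N : lmodType K)
    (mul : {bilinear N -> N -> N}) x u c v d :
  novikov mul ->
  associator mul (associator mul x u c) v d =
  associator mul (associator mul x v d) u c.
Proof.
move=> nov; rewrite {1}[associator mul (associator _ _ _ _) v d]/associator.
rewrite -!associator_mull // [X in _ = associator _ X _ _]/associator.
by rewrite addrC [in RHS]addrC -!scaleN1r associatorPl.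
Qed.

(** As (x,u,c) is symmetric in x and u, the commutation
    T_{v,d} T_{x,c} u = T_{x,c} T_{v,d} u moves the operator T_{v,d} from the
    value of (x,u,c) to its middle argument. *)
Lemma associator_nest (K : fieldType) (N : lmodType K)
    (mul : {bilinear N -> N -> N}) x u c v d :
  novikov mul ->
  associator mul (associator mul x u c) v d =
  associator mul x (associator mul u v d) c.
Proof.
move=> nov; have [lsym _] := nov.
by rewrite [associator mul x u c]lsym associatorAC // lsym.
Qed.

Lemma commutator_mull (K : fieldType) (N : lmodType K)
    (mul : {bilinear N -> N -> N}) a b c :
  novikov mul ->
  commutator mul (mul a c) b =
  mul (commutator mul a b) c + associator mul a b c.
Proof.
case=> lsym rcomm; rewrite lsym /commutator /associator linearBl.
by rewrite (rcomm a c b) addrA subrK.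
Qed.

Lemma commutator_mulr (K : fieldType) (N : lmodType K)
    (mul : {bilinear N -> N -> N}) a b c :
  novikov mul ->
  commutator mul a (mul b c) =
  mul (commutator mul a b) c - associator mul a b c.
Proof.
case=> lsym rcomm; rewrite /commutator /associator linearBl.
by rewrite (rcomm b c a) opprB [RHS]addrC subrKA.
Qed.

Lemma mulr_commutator (K : fieldType) (N : lmodType K)
    (mul : {bilinear N -> N -> N}) x a b :
  novikov mul ->
  mul x (commutator mul a b) = associator mul x b a - associator mul x a b.
Proof.
case=> _ rcomm; rewrite /commutator /associator linearBr (rcomm x b a).
by rewrite opprB [RHS]addrC subrKA.
Qed.

(** * The derived series *)

(** Adding the formulas for [ac,b] and [a,bc] cancels the associators and
    leaves 2[a,b]c. *)
Lemma prod_span_commutator_mulr (K : fieldType)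
    (char_neq2 : 2%N \notin [pchar K]) (N : lmodType K)
    (mul : {bilinear N -> N -> N}) (D : set N) :
  novikov mul -> (forall x c, D x -> D (mul x c)) ->
  forall x c, prod_span (commutator mul) D D x ->
    prod_span (commutator mul) D D (mul x c).
Proof.
move=> nov Dr x c; move: x; apply: lin_span_sub.
- by rewrite linear0l; apply: lin_span0.
- by move=> a x y Dx Dy; rewrite linearPl; apply: lin_spanP.
move=> _ [a Da [b Db <-]]; apply: (lin_span_half _ char_neq2).
have -> : mul (commutator mul a b) c + mul (commutator mul a b) c =
    commutator mul (mul a c) b + commutator mul a (mul b c).
  by rewrite commutator_mull // commutator_mulr // addrACA subrr addr0.
by apply: lin_spanD; apply: lin_span_incl;
  [exists (mul a c); [exact: Dr | exists b] | exists a => //; exists (mul b c);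
   [exact: Dr |]].
Qed.

Lemma derived_series_mulr (K : fieldType) (char_neq2 : 2%N \notin [pchar K])
    (N : lmodType K) (mul : {bilinear N -> N -> N}) :
  novikov mul ->
  forall j x c, derived_series (commutator mul) j x ->
    derived_series (commutator mul) j (mul x c).
Proof.
move=> nov; elim=> [//|j IH] x c.
exact: prod_span_commutator_mulr.
Qed.

(** Subtracting the formulas for [ac,b] and [a,bc] instead leaves
    2(a,b,c). *)
Lemma associator_derived (K : fieldType) (char_neq2 : 2%N \notin [pchar K])
    (N : lmodType K) (mul : {bilinear N -> N -> N}) j a b c :
  novikov mul ->
  derived_series (commutator mul) j a -> derived_series (commutator mul) j b ->
  derived_series (commutator mul) j.+1 (associator mul a b c).
Proof.
move=> nov Da Db; apply: (lin_span_half _ char_neq2).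
have -> : associator mul a b c + associator mul a b c =
    commutator mul (mul a c) b - commutator mul a (mul b c).
  by rewrite commutator_mull // commutator_mulr // opprB [RHS]addrC subrKA.
by apply: lin_spanB; apply: lin_span_incl;
  [exists (mul a c); [exact: derived_series_mulr | exists b]
  | exists a => //; exists (mul b c); [exact: derived_series_mulr |]].
Qed.

(** * Products of the operators x |-> (x,u,c) *)

Definition iter_associator {N : zmodType} (mul : N -> N -> N)
    (s : seq (N * N)) (x : N) : N :=
  foldr (fun p y => associator mul y p.1 p.2) x s.

Lemma iter_associator_cat (N : zmodType) (mul : N -> N -> N) s t x :
  iter_associator mul (s ++ t) x =
  iter_associator mul s (iter_associator mul t x).
Proof. exact: foldr_cat. Qed.

Lemma iter_associatorP (K : fieldType) (N : lmodType K)
    (mul : {bilinear N -> N -> N}) s a x y :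
  iter_associator mul s (a *: x + y) =
  a *: iter_associator mul s x + iter_associator mul s y.
Proof. by elim: s => //= p s ->; rewrite associatorPl. Qed.

(** Each of the two halves of s collapses to one operator with index in D_j,
    and [associator_nest] merges the two into one with index (z,y,c), which
    lies in D_{j+1}. *)
Lemma iter_associator_derived (K : fieldType)
    (char_neq2 : 2%N \notin [pchar K]) (N : lmodType K)
    (mul : {bilinear N -> N -> N}) j (s : seq (N * N)) :
  novikov mul -> size s = (2 ^ j)%N ->
  exists y c, derived_series (commutator mul) j y /\
    forall x, iter_associator mul s x = associator mul x y c.
Proof.
move=> nov; elim: j s => [|j IH] s.
  by case: s => [//|[y c] []] // _; exists y, c.
rewrite expnS mul2n -addnn => sz_s.
have [|y [c [Dy s1E]]] := IH (take (2 ^ j) s).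
  by rewrite size_takel // sz_s leq_addr.
have [|z [d [Dz s2E]]] := IH (drop (2 ^ j) s).
  by rewrite size_drop sz_s addnK.
exists (associator mul z y c), d; split; first exact: associator_derived.
move=> x; rewrite -[s in LHS](cat_take_drop (2 ^ j)) iter_associator_cat.
by rewrite s2E s1E associator_nest.
Qed.

Lemma iter_associator_eq0 (K : fieldType) (char_neq2 : 2%N \notin [pchar K])
    (N : lmodType K) (mul : {bilinear N -> N -> N}) n s x :
  novikov mul -> derived_series (commutator mul) n = [set 0]%classic ->
  size s = (2 ^ n)%N -> iter_associator mul s x = 0.
Proof.
move=> nov Dn0 sz_s.
have [y [c [Dy ->]]] := iter_associator_derived _ char_neq2 _ _ _ _ nov sz_s.
move: Dy; rewrite Dn0 => /= ->; have [lsym _] := nov.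
by rewrite lsym /associator !linear0l subrr.
Qed.

(** * Right powers of the commutator ideal *)

(** By [mulr_commutator], an element of M^[k+1], with M = [N,N], is a
    combination of values of products of k operators T_{u,c}; the m - k
    operators of s complete these products to length m. *)
Lemma iter_associator_right_power (K : fieldType)
    (N : lmodType K) (mul : {bilinear N -> N -> N}) m :
  novikov mul ->
  (forall s x, size s = m -> iter_associator mul s x = 0) ->
  forall k x s, right_power mul (commutator_ideal mul) k.+1 x ->
    (size s + k)%N = m -> iter_associator mul s x = 0.
Proof.
move=> nov T0.
have iter0 s : iter_associator mul s 0 = 0.
  by have := iter_associatorP _ _ mul s (-1) 0 0; rewrite !scaleN1r !addNr.
elim=> [|k IH] x s; first by rewrite addn0 => _; apply: T0.
move=> Mx sz_s; move: x Mx; apply: lin_span_sub => //.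
  by move=> a x y xs0 ys0; rewrite iter_associatorP xs0 ys0 scaler0 addr0.
move=> _ [y My [w Mw <-]]; move: w Mw; apply: lin_span_sub.
- by rewrite linear0r.
- move=> a x w xs0 ws0.
  by rewrite linearPr iter_associatorP xs0 ws0 scaler0 addr0.
move=> _ [a _ [b _ <-]]; rewrite mulr_commutator // addrC -scaleN1r.
have T_rcons u c : iter_associator mul s (associator mul y u c) = 0.
  rewrite -(iter_associator_cat _ _ _ [:: (u, c)]).
  by apply: IH; rewrite // size_cat -addnA.
by rewrite iter_associatorP !T_rcons scaler0 addr0.
Qed.

Theorem theorem1 (K : fieldType) (char_neq2 : 2%N \notin [pchar K])
    (N : lmodType K) (mul : {bilinear N -> N -> N}) :
  novikov mul -> lie_solvable mul ->
  right_nilpotent mul (commutator_ideal mul).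
Proof.
move=> nov [n Dn0]; exists (2 ^ n).+1; split=> //.
rewrite eqEsubset; split=> x /=.
  move=> Mx.
  apply: (iter_associator_right_power _ _ _ _ nov _ _ _ [::] Mx erefl).
  by move=> s y; apply: iter_associator_eq0.
(* As 2 ^ n > 0, the right power is a product of subspaces, hence a span. *)
move=> ->; rewrite /right_power /= -(prednK (expn_gt0 2 n)) /=.
exact: lin_span0.
Qed.
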